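(* Suppose there is a number $\rho$ such that $\rho_i=\rho$ for all $i\in N$ and $\rho\le\min\{c_{ij}: i\in N,\ j\in F\}$. Then the optimal solution $(y,x,u)$ of the two-stage robust bilevel facility location problem (2-stage RBO-FLP) and the optimal solution $(y,x,u)$ of the two-stage robust facility location problem (2-stage RO-FLP) are both $(\mathbf 0,\mathbf 0,\mathbf d)$, where $\mathbf d=(d_i)_{i\in N}$.
   Context: Data: finite nonempty sets $N$ (customers) and $F$ (facilities); real numbers, all nonnegative: fixed cost $f_j$ and capacity $K_j$ for $j\in F$; demand $d_i$ and unit unmet-demand penalty $\rho_i$ for $i\in N$; unit allocation (transportation) cost $c_{ij}$ for $i\in N,j\in F$; and a nonnegative integer $\Gamma$. Uncertainty set: $\mathcal U=\{s\in\{0,1\}^{F}:\sum_{j\in F}s_j\le\Gamma\}$. For $y\in\{0,1\}^F$ and $s\in\mathcal U$, let $X(y,s)$ be the set of $(x,u)\in\mathbb R^{N\times F}\times\mathbb R^{N}$ with $x\ge0$, $u\ge0$, $\sum_{i\in N}x_{ij}\le K_jy_j(1-s_j)$ for all $j\in F$, and $\sum_{j\in F}x_{ij}+u_i=d_i$ for all $i\in N$. Let $\phi(y,s)=\operatorname{argmin}\{\sum_{i\in N}u_i:(x,u)\in X(y,s)\}$. 2-stage RBO-FLP: $\min_{y\in\{0,1\}^{F}}\Big(\sum_{j\in F}f_jy_j+\max_{s\in\mathcal U}\min_{(x,u)\in\phi(y,s)}\big(\sum_{i\in N}\sum_{j\in F}c_{ij}x_{ij}+\sum_{i\in N}\rho_iu_i\big)\Big)$.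 2-stage RO-FLP: the same problem with $\phi(y,s)$ replaced by $X(y,s)$. In both problems $y$ is the first-stage decision and $(x,u)$ is the second-stage decision. *)

(* Defs.v *)
From HB Require Import structures.
From mathcomp Require Import all_boot all_order all_algebra.
From mathcomp Require Import boolp classical_sets reals ereal.

Set Implicit Arguments.
Unset Strict Implicit.
Unset Printing Implicit Defensive.

Import Order.TTheory GRing.Theory Num.Theory.
Local Open Scope classical_set_scope.
Local Open Scope ring_scope.

(* Facility location data with customers N and facilities F. *)
Record flp (R : realType) (N F : finType) := Flp {
  fixed_cost : F -> R;
  capacity : F -> R;
  demand : N -> R;
  penalty : N -> R;
  alloc_cost : N -> F -> R;
  budget : nat;
  fixed_cost_ge0 : forall j, 0 <= fixed_cost j;
  capacity_ge0 : forall j, 0 <= capacity j;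
  demand_ge0 : forall i, 0 <= demand i;
  penalty_ge0 : forall i, 0 <= penalty i;
  alloc_cost_ge0 : forall i j, 0 <= alloc_cost i j }.

Definition argmin (R : realType) (T : Type) (A : set T) (g : T -> R) : set T :=
  [set z | A z /\ forall z', A z' -> g z <= g z'].

Section TwoStage.
Variables (R : realType) (N F : finType) (I : flp R N F).

(* A 0/1 vector indexed by F: a facility plan y, or a scenario s of failures. *)
Definition binvec := {ffun F -> bool}.

(* A second-stage decision is a pair (x, u). *)
Definition recourse := ((N -> F -> R) * (N -> R))%type.

Definition uncertainty : {set binvec} :=
  [set s : binvec | (\sum_(j : F) s j <= budget I)%N]%SET.

Definition feasible (y s : binvec) : set recourse :=
  [set xu | [/\ forall i j, 0 <= xu.1 i j,
                forall i, 0 <= xu.2 i,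
                forall j, \sum_(i : N) xu.1 i j
                          <= capacity I j * (y j)%:R * (1 - (s j)%:R)
              & forall i, \sum_(j : F) xu.1 i j + xu.2 i = demand I i]].

Definition unmet (xu : recourse) : R := \sum_(i : N) xu.2 i.

Definition lower_level (y s : binvec) : set recourse :=
  argmin (feasible y s) unmet.

Definition recourse_cost (xu : recourse) : R :=
  \sum_(i : N) \sum_(j : F) alloc_cost I i j * xu.1 i j
  + \sum_(i : N) penalty I i * xu.2 i.

(* Z y s is the set over which the innermost minimum is taken. That minimum is
   rendered as an infimum in the extended reals, hence +oo if Z y s is empty. *)
Definition robust_objective (Z : binvec -> binvec -> set recourse)
    (y : binvec) : \bar R :=
  ((\sum_(j : F) fixed_cost I j * (y j)%:R)%:E
   + \big[Order.max/-oo]_(s in uncertainty)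
       ereal_inf [set (recourse_cost xu)%:E | xu in Z y s])%E.

(* The second-stage decision is taken after the scenario is revealed, so x and u
   are functions of s, required to be optimal in every scenario. *)
Definition two_stage_optimal (Z : binvec -> binvec -> set recourse)
    (y : binvec) (x : binvec -> N -> F -> R) (u : binvec -> N -> R) : Prop :=
  (forall y' : binvec, (robust_objective Z y <= robust_objective Z y')%E) /\
  (forall s, s \in uncertainty -> argmin (Z y s) recourse_cost (x s, u s)).

Definition RBO_FLP_optimal := two_stage_optimal lower_level.

Definition RO_FLP_optimal := two_stage_optimal feasible.

End TwoStage.

(* Main.v *)
(** Because [rho <= c_ij], serving a unit of demand never costs less than leaving
    it unmet, so every feasible recourse costs at least [rho * sum_i d_i], whatever
    the plan and the scenario. The plan [y = 0] has no fixed cost and attains this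
    bound: its only feasible recourse is [(0, d)], for which the lower-level
    restriction is vacuous. *)

Require Import Defs.
From HB Require Import structures.
From mathcomp Require Import all_boot all_order all_algebra.
From mathcomp Require Import boolp classical_sets reals ereal.

Set Implicit Arguments.
Unset Strict Implicit.
Unset Printing Implicit Defensive.

Import Order.TTheory GRing.Theory Num.Theory.
Local Open Scope ring_scope.

Section UniformPenalty.
Variables (R : realType) (N F : finType) (I : flp R N F).

Local Notation no_facility := ([ffun _ => false] : binvec F).
Local Notation no_service := ((fun _ _ => 0, demand I) : recourse R N F).

Lemma no_service_feasible (s : binvec F) : feasible I no_facility s no_service.
Proof.
split=> //= [i|j|i]; first exact: demand_ge0.
- by rewrite big1 // ffunE mulr0 mul0r.
- by rewrite big1 // add0r.
Qed.

(** With every facility closed all capacities vanish, so each nonnegative [x i j], bounded by its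
    column sum, is zero and the demand balance leaves [u = d]. *)
Lemma feasible_no_facility (s : binvec F) xu :
  feasible I no_facility s xu -> xu.2 =1 demand I.
Proof.
case=> x_ge0 _ cap dem i; rewrite -dem big1 ?add0r // => j _.
apply/eqP; rewrite eq_le x_ge0 andbT.
apply: (le_trans _ (le_trans (cap j) _)); last by rewrite ffunE mulr0 mul0r.
by rewrite (bigD1 i) //= lerDl sumr_ge0.
Qed.

Lemma no_service_lower_level (s : binvec F) :
  lower_level I no_facility s no_service.
Proof.
split=> [|xu /feasible_no_facility xuE]; first exact: no_service_feasible.
by rewrite /unmet (eq_bigr _ (fun i _ => xuE i)).
Qed.

Variable rho : R.
Hypothesis penalty_rho : forall i, penalty I i = rho.
Hypothesis rho_le_cost : forall i j, rho <= alloc_cost I i j.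

Lemma recourse_cost_no_service :
  recourse_cost I no_service = \sum_i rho * demand I i.
Proof.
rewrite /recourse_cost /= big1 ?add0r => [|i _].
  by apply: eq_bigr => i _; rewrite penalty_rho.
by rewrite big1 // => j _; rewrite mulr0.
Qed.

Lemma le_recourse_cost (y s : binvec F) xu :
  feasible I y s xu -> recourse_cost I no_service <= recourse_cost I xu.
Proof.
case=> x_ge0 _ _ dem; rewrite recourse_cost_no_service /recourse_cost -big_split.
(* The demand balance splits [rho * d_i] into a served and an unmet part; the unmet parts cancel,
   leaving [rho * x i j] against [c_ij * x i j]. *)
apply: ler_sum => i _; rewrite -dem mulrDr penalty_rho lerD2r mulr_sumr.
by apply: ler_sum => j _; rewrite ler_wpM2r.
Qed.

(** Keeping [Z] abstract treats both problems at once: the cost bound passes to any subset of the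
    feasible recourses, and [Z0] ensures that it is attained. *)
Lemma no_service_optimal (Z : binvec F -> binvec F -> set (recourse R N F)) :
  (forall y s, (Z y s `<=` feasible I y s)%classic) ->
  (forall s, Z no_facility s no_service) ->
  two_stage_optimal I Z no_facility (fun _ _ _ => 0) (fun _ => demand I).
Proof.
move=> Zfeas Z0; split=> [y|s _]; last first.
  by split=> // xu /Zfeas; apply: le_recourse_cost.
apply: leeD.
  rewrite lee_fin big1 => [|j _]; last by rewrite ffunE mulr0.
  by apply: sumr_ge0 => j _; rewrite mulr_ge0 ?fixed_cost_ge0.
(* The cost of [no_service] separates the two maxima. *)
apply: (@le_trans _ _ (recourse_cost I no_service)%:E).
  apply: bigmax_le => [|s _]; first exact: leNye.
  by apply: ereal_inf_lbound; exists no_service.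
(* Here [no_facility] is read as the scenario without failures, which fits any budget; an empty
   [Z y s] gives [+oo] and keeps the bound. *)
apply: (@le_trans _ _ (ereal_inf
    [set (recourse_cost I xu)%:E | xu in Z y no_facility]%classic)).
  apply: le_ereal_inf_tmp => _ [xu /Zfeas xu_feas <-].
  by rewrite lee_fin (le_recourse_cost xu_feas).
by apply: le_bigmax_cond; rewrite inE big1 // => j _; rewrite ffunE.
Qed.

End UniformPenalty.

Theorem proposition4 (R : realType) (N F : finType)
    (N_neq0 : (0 < #|N|)%N) (F_neq0 : (0 < #|F|)%N)
    (I : flp R N F) (rho : R)
    (penalty_rho : forall i : N, penalty I i = rho)
    (rho_le_cost : forall (i : N) (j : F), rho <= alloc_cost I i j) :
  RBO_FLP_optimal I [ffun _ => false] (fun _ _ _ => 0) (fun _ => demand I) /\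
  RO_FLP_optimal I [ffun _ => false] (fun _ _ _ => 0) (fun _ => demand I).
Proof.
split; apply: (no_service_optimal penalty_rho rho_le_cost).
- by move=> y s xu [].
- exact: no_service_lower_level.
- by move=> y s.
- exact: no_service_feasible.
Qed.
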